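(* Let $k\ge3$ be an integer, let $\lambda\in\mathbb{C}\setminus\{-n/2:n\in\mathbb{N}\}$, and let $\{p_n\}_{n\ge0}$ be the monic sieved OPS of the first kind: $p_0=1$ and $p_n(x)=\vartheta_{n-1}c_n^\lambda(x;k)$ for $n\ge1$, with $\vartheta_n:=(2\lambda+1)_{\lfloor n/k\rfloor}/\{2^n(\lambda+1)_{\lfloor n/k\rfloor}\}$. Then $\{p_n\}_{n\ge0}$ satisfies the structure relation $$\Phi(x)\,p_{nk+j}'(x)=M_{nk+j}(x)\,p_{nk+j+1}(x)+N_{nk+j}(x)\,p_{nk+j}(x)$$ for every $n=0,1,2,\dots$ and $0\le j\le k-1$, where $$\Phi(x)=(1-x^2)\widehat U_{k-1}(x),$$ $$M_{nk+j}(x)=-2(nk+j+\lambda k)\widehat U_{k-1}(x)-\tfrac{\lambda k}{2}\big(\widehat U_{j-1}(x)\widehat U_{k-j-2}(x)-\widehat U_{j-2}(x)\widehat U_{k-j-1}(x)\big),$$ $$N_{nk+j}(x)=(nk+j+2\lambda k)\,x\,\widehat U_{k-1}(x)-\lambda k\,\epsilon_j\,\widehat U_{k-2}(x)+\tfrac{\lambda k}{8}\big(\widehat U_{j-1}(x)\widehat U_{k-j-3}(x)-\widehat U_{j-2}(x)\widehat U_{k-j-2}(x)\big),$$ with $\epsilon_{k-1}:=1$, $\epsilon_0:=0$, and $\epsilon_j:=\frac12$ for $1\le j\le k-2$.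
   Context: $\mathbb{N}=\{1,2,\dots\}$. $(\alpha)_0:=1$ and $(\alpha)_n:=\alpha(\alpha+1)\cdots(\alpha+n-1)$ for $n\ge1$. OPS = orthogonal polynomial sequence (with respect to a regular linear functional on complex polynomials). Chebyshev polynomials of the second kind: $U_n(\cos\theta)=\sin((n+1)\theta)/\sin\theta$; monic version $\widehat U_n:=2^{-n}U_n$ for $n\ge0$, and by convention $\widehat U_n:=0$ for every negative index $n$. Sieved ultraspherical polynomials of the first kind: the polynomials $C_n(x;\beta|q)$ are defined by $C_0(x;\beta|q)=1$, $C_1(x;\beta|q)=2x(1-\beta)/(1-q)$ and, for $n\ge 1$, $2x(1-\beta q^n)C_n=(1-q^{n+1})C_{n+1}+(1-\beta^2q^{n-1})C_{n-1}$, with $|q|<1$. They are renormalized as $C_n(x;\beta|q)=\frac{(\beta^2;q)_n}{(q;q)_n}c_n(x;\beta|q)$, where $(a;q)_0:=1$, $(a;q)_n:=\prod_{j=1}^n(1-aq^{j-1})$; equivalently $c_0=1$, $c_1=2x/(1+\beta)$ and $2x(1-\beta q^n)c_n=(1-\beta^2q^n)c_{n+1}+(1-q^n)c_{n-1}$ for $n\ge1$ (this form is used also when $\beta=1$, i.e. $\lambda=0$). With $\omega_k:=e^{2\pi i/k}$, $c_n^\lambda(x;k):=\lim_{s\to1}c_n(x;s^{\lambda k}\,|\,s\omega_k)$ (limit over $s\in(0,1)$). Equivalently, the monic polynomials $p_n$ satisfy $p_0=1$, $p_1=x$, $p_{N+1}=xp_N-\gamma_Np_{N-1}$ ($N\ge1$),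 where $\gamma_{mk}=\frac{m}{4(m+\lambda)}$ and $\gamma_{mk+1}=\frac{m+2\lambda}{4(m+\lambda)}$ for $m\ge1$, $\gamma_1=\frac12$, and $\gamma_N=\frac14$ for all other $N\ge1$. *)

(* Defs.v *)
From HB Require Import structures.
From mathcomp Require Import all_boot all_order all_algebra.
From mathcomp Require Import complex ring.
From mathcomp Require Import all_classical all_reals all_analysis.

Set Implicit Arguments.
Unset Strict Implicit.
Unset Printing Implicit Defensive.

Import Order.TTheory GRing.Theory Num.Theory.
Import numFieldNormedType.Exports.
Local Open Scope ring_scope.
Local Open Scope complex_scope.
Local Open Scope classical_set_scope.

Definition pochhammer (F : nzRingType) (a : F) (n : nat) : F :=
  \prod_(i < n) (a + i%:R).

(* Characterized by chebyU_cos below. *)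
Fixpoint chebyU (F : nzRingType) (n : nat) : {poly F} :=
  if n is m.+1 then
    if m is l.+1 then 2 *: 'X * chebyU F m - chebyU F l else 2 *: 'X
  else 1.

Definition monicU (F : fieldType) (m : int) : {poly F} :=
  match m with
  | Posz n => 2 ^- n *: chebyU F n
  | Negz _ => 0
  end.

Section ComplexNumbers.
Variable R : realType.

Definition cexp (z : R[i]) : R[i] :=
  (expR (complex.Re z))%:C * (cos (complex.Im z) +i* sin (complex.Im z)).

(* s^z for real s > 0 *)
Definition cpow (s : R) (z : R[i]) : R[i] := cexp ((ln s)%:C * z).

Definition omega (k : nat) : R[i] := cexp (0 +i* (2 * pi / k%:R)).

Lemma chebyU_cos (t : R) (n : nat) :
  (chebyU R n).[cos t] * sin t = sin (n.+1%:R * t).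
Proof.
suff: (chebyU R n).[cos t] * sin t = sin (n.+1%:R * t) /\
      (chebyU R n.+1).[cos t] * sin t = sin (n.+2%:R * t) by case.
elim: n => [|n [IH0 IH1]].
  rewrite /= !hornerE; split=> //.
  by rewrite [2 * t]mulr_natl mulr2n sinD; ring.
split=> //; rewrite [chebyU R n.+2]/(2 *: 'X * chebyU R n.+1 - chebyU R n).
rewrite !hornerE mulrBl -[_ * sin t]mulrA IH1 IH0.
have -> : n.+3%:R * t = n.+2%:R * t + t by rewrite -natr1 mulrDl mul1r.
have -> : n.+1%:R * t = n.+2%:R * t - t by rewrite -[n.+2%:R]natr1; ring.
by rewrite sinB sinD; ring.
Qed.

End ComplexNumbers.

Section SievedUltraspherical.
Variable R : realType.
Local Notation C := R[i].

(* The recurrence 2x (1 - b q^m) c_m = (1 - b^2 q^m) c_{m+1} + (1 - q^m) c_{m-1},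
   m >= 1, solved for c_{m+1}. *)
Fixpoint qultra (b q : C) (n : nat) : {poly C} :=
  if n is m.+1 then
    if m is l.+1 then
      (1 - b ^+ 2 * q ^+ m)^-1 *:
        ((2 * (1 - b * q ^+ m)) *: 'X * qultra b q m - (1 - q ^+ m) *: qultra b q l)
    else (2 / (1 + b)) *: 'X
  else 1.

Definition qsieved (k : nat) (lam : C) (n : nat) (s : R) : {poly C} :=
  qultra (cpow s (lam * k%:R)) (s%:C * omega R k) n.

(* The polynomial that is the pointwise limit of qsieved k lam n s as s -> 1,
   s < 1; C^o carries the topology of the modulus on C. *)
Definition sieved (k : nat) (lam : C) (n : nat) : {poly C} :=
  xget 0 [set p : {poly C} | forall x : C,
    ((qsieved k lam n s).[x] : C^o) @[s --> (1 : R)^'-] --> (p.[x] : C^o)].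

Definition vartheta (k : nat) (lam : C) (n : nat) : C :=
  pochhammer (2 * lam + 1) (n %/ k) / (2 ^+ n * pochhammer (lam + 1) (n %/ k)).

Definition monic_sieved (k : nat) (lam : C) (n : nat) : {poly C} :=
  if n is m.+1 then vartheta k lam m *: sieved k lam n else 1.

Local Notation U := (monicU C).

Definition sieved_eps (k j : nat) : C :=
  if j == 0%N then 0 else if j == k.-1 then 1 else 1 / 2.

Definition sieved_Phi (k : nat) : {poly C} := (1 - 'X^2) * U (k%:Z - 1).

Definition sieved_M (k : nat) (lam : C) (n j : nat) : {poly C} :=
  - (2 * ((n * k + j)%:R + lam * k%:R)) *: U (k%:Z - 1)
  - (lam * k%:R / 2) *:
      (U (j%:Z - 1) * U (k%:Z - j%:Z - 2) - U (j%:Z - 2) * U (k%:Z - j%:Z - 1)).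

Definition sieved_N (k : nat) (lam : C) (n j : nat) : {poly C} :=
  ((n * k + j)%:R + 2 * lam * k%:R) *: 'X * U (k%:Z - 1)
  - (lam * k%:R * sieved_eps k j) *: U (k%:Z - 2)
  + (lam * k%:R / 8) *:
      (U (j%:Z - 1) * U (k%:Z - j%:Z - 3) - U (j%:Z - 2) * U (k%:Z - j%:Z - 2)).

End SievedUltraspherical.

(* Main.v *)
Require Import Defs.
From HB Require Import structures.
From mathcomp Require Import all_boot all_order all_algebra.
From mathcomp Require Import complex ring lra zify.
From mathcomp Require Import all_classical all_reals all_analysis.

Import Order.TTheory GRing.Theory Num.Theory.
Import numFieldNormedType.Exports.
Local Open Scope ring_scope.
Local Open Scope complex_scope.
Local Open Scope classical_set_scope.

(** Why the relation holds.  Write S_m for the polynomial with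
    S_m (cos t) = sin (m t) / sin t, m any integer.  Every Chebyshev factor in
    Phi, M and N is a scaled S_m, and the identity
    S_{j+1} S_l - S_j S_{l+1} = S_{l-j} collapses the differences of products.
    After division by the common constant 2^(1-k), the coefficients become,
    with N = nk + j,
      Phi = (1 - x^2) S_k,
      M_N = -2 (N + lam k) S_k - 2 lam k S_{k-2j}      (no second term if j = 0),
      N_N = (N + 2 lam k) x S_k - lam k S_{k-1} + lam k S_{k-1-2j}.
    The boundary conventions of the original formulas (vanishing Chebyshev
    polynomials of negative index, the values of eps) are exactly those that
    make the formula for N_N uniform in j; only M_N keeps an exception at j = 0.

    Given the monic recurrence p_{N+1} = x p_N - gamma_N p_{N-1}, the relations
    at N - 1 and N imply the one at N + 1 as soon as the coefficients satisfy
      x M_N + N_{N-1} = x M_{N+1} + N_{N+1},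
      Phi + x (N_N - N_{N-1}) = gamma_N M_{N-1} - gamma_{N+1} M_{N+1}
    ([structure_relation_ind]).  Both follow from the three-term recurrence of
    the S_m ([compat_next], [compat_same]).  In the second one the exceptional
    values of gamma next to the multiples of k compensate the exception in M:
    each product gamma M occurring there, except when N is a multiple of k, is
    1/4 times the regular expression ([gamma_succ_scaledM], [gamma_scaledM]).

    The recurrence of the p_N comes from the limit s -> 1 in the recurrence of
    the c_m (x; s^(lam k) | s omega_k).  If k does not divide m then
    q^m tends to omega_k^m, which is not 1, and the coefficients tend to the
    Chebyshev ones.  If m = nk then q^m = s^m and the coefficients are
    quotients (1 - s^w) / (1 - s^z), with limit w / z because 1 - s^z is
    equivalent to z (1 - s) ([tends_cpow_ratio], [tends_coef]).  As a polynomial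
    is determined by its values, the pointwise limit is the polynomial given by
    the limit recurrence ([sievedE]). *)

(** * The polynomials sin (m t) / sin t *)

Section SinU.
Variable F : comNzRingType.

(** sin (m t) / sin t as a polynomial in cos t: the Chebyshev polynomial of
    index m - 1, extended to negative m as an odd function of m so that the
    three-term recurrence holds for all integers. *)
Definition sinU (m : int) : {poly F} :=
  match m with
  | Posz 0 => 0
  | Posz n.+1 => chebyU F n
  | Negz n => - chebyU F n
  end.

Lemma chebyUSS n : chebyU F n.+2 = 2 * 'X * chebyU F n.+1 - chebyU F n.
Proof. by rewrite mulr_natl -scaler_nat. Qed.

Lemma sinU_Negz n : sinU (Negz n) = - chebyU F n. Proof. by []. Qed.

Lemma sinU_rec (m : int) : sinU (m + 2) = 2 * 'X * sinU (m + 1) - sinU m.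
Proof.
case: m => [[|n]|[|[|n]]].
- by rewrite /= subr0 mulr1 mulr_natl -scaler_nat.
- have -> : n.+1%:Z + 2 = n.+3 by lia.
  have -> : n.+1%:Z + 1 = n.+2 by lia.
  exact: chebyUSS.
- by rewrite /= mulr0 sub0r opprK.
- by rewrite /= mulrN mulr1 opprK mulr_natl -scaler_nat addNr.
have -> : Negz n.+2 + 2 = Negz n by lia.
have -> : Negz n.+2 + 1 = Negz n.+1 by lia.
by rewrite !sinU_Negz chebyUSS; ring.
Qed.

Lemma sinU_succ (a : int) : sinU (a + 1) = 2 * 'X * sinU a - sinU (a - 1).
Proof.
have -> : a + 1 = a - 1 + 2 by lia.
by rewrite sinU_rec subrK.
Qed.

Lemma sinUN m : sinU (- m) = - sinU m.
Proof.
case: m => [[|n]|n]; first by rewrite oppr0 /= oppr0.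
- by rewrite -NegzE.
by rewrite NegzE opprK /= opprK.
Qed.

(** With sines this is
    sin ((j+1) t) sin (l t) - sin (j t) sin ((l+1) t) = sin t sin ((l-j) t);
    the left-hand side is unchanged when j and l both increase by one. *)
Lemma sinU_cross (j l : nat) :
  sinU j.+1 * sinU l - sinU j * sinU l.+1 = sinU (l%:Z - j%:Z).
Proof.
elim: j l => [|j IH] [|l]; rewrite ?subr0 ?sub0r.
- by rewrite mulr0 mul0r subr0.
- by rewrite mul1r mul0r subr0.
- by rewrite mulr0 mulr1 sub0r sinUN.
have -> : (l.+1%:Z - j.+1%:Z) = l%:Z - j%:Z by lia.
rewrite -IH.
have rec i : sinU i.+2 = 2 * 'X * sinU i.+1 - sinU i.
  have -> : i.+2%:Z = i%:Z + 2 by lia.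
  have -> : i.+1%:Z = i%:Z + 1 by lia.
  exact: sinU_rec.
by rewrite (rec l) (rec j); ring.
Qed.
End SinU.

(** Index -1 is included, where both sides vanish; at -2 the convention for
    [monicU] departs from the odd extension [sinU]. *)
Lemma monicU_sinU (F : numFieldType) (i : nat) :
  monicU F (i%:Z - 1) = (2 / 2 ^+ i) *: sinU F i.
Proof.
case: i => [|i]; first by rewrite scaler0.
have -> : i.+1%:Z - 1 = i by lia.
by rewrite /= exprS invfM mulrA divff ?mul1r ?pnatr_eq0//.
Qed.

Lemma monicU_cross (F : numFieldType) (j l : nat) :
  monicU F (j.+1%:Z - 1) * monicU F (l%:Z - 1) -
  monicU F (j%:Z - 1) * monicU F (l.+1%:Z - 1) =
    (2 / 2 ^+ (j + l)) *: sinU F (l%:Z - j%:Z).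
Proof.
rewrite !monicU_sinU -sinU_cross !exprS exprD -!scalerAl -!scalerAr !scalerA scalerBr.
have e2 : 2 != 0 :> F by rewrite pnatr_eq0.
have ej : 2 ^+ j != 0 :> F by rewrite expf_neq0.
have el : 2 ^+ l != 0 :> F by rewrite expf_neq0.
by congr (_ *: _ - _ *: _); field; rewrite ej el.
Qed.

(** * Structure relations propagated by a three-term recurrence *)

Section Structure.
Variables (F : comNzRingType) (p M N : nat -> {poly F}) (g : nat -> F).
Variable Phi : {poly F}.

(** Differentiate the recurrence, multiply by Phi, insert the two known
    relations and eliminate p_i through g_{i+1} p_i = x p_{i+1} - p_{i+2}: the
    two compatibility conditions equate the resulting coefficients of p_{i+2}
    and p_{i+1} with those of the relation at i + 2. *)
Lemma structure_relation_ind :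
  (forall i, p i.+2 = 'X * p i.+1 - g i.+1 *: p i) ->
  (forall i, 'X * M i.+1 + N i = 'X * M i.+2 + N i.+2) ->
  (forall i, Phi + 'X * (N i.+1 - N i) = g i.+1 *: M i - g i.+2 *: M i.+2) ->
  Phi * (p 0)^`() = M 0 * p 1 + N 0 * p 0 ->
  Phi * (p 1)^`() = M 1 * p 2 + N 1 * p 1 ->
  forall i, Phi * (p i)^`() = M i * p i.+1 + N i * p i.
Proof.
move=> prec eq1 eq2 r0 r1 i.
suff: Phi * (p i)^`() = M i * p i.+1 + N i * p i /\
  Phi * (p i.+1)^`() = M i.+1 * p i.+2 + N i.+1 * p i.+1 by case.
elim: i => [//|i [IH0 IH1]]; split=> //.
have -> : Phi * (p i.+2)^`() = Phi * p i.+1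
    + 'X * (Phi * (p i.+1)^`()) - (g i.+1)%:P * (Phi * (p i)^`()).
  by rewrite prec -mul_polyC !poly.derivE; ring.
have ei := eq1 i; have {}eq2 := eq2 i.
have -> : N i.+2 = 'X * M i.+1 + N i - 'X * M i.+2 by rewrite ei; ring.
have PhiE : Phi = (g i.+1)%:P * M i - (g i.+2)%:P * M i.+2 - 'X * (N i.+1 - N i).
  by rewrite !mul_polyC -eq2; ring.
rewrite IH0 IH1 [in X in X + _ - _]PhiE (prec i.+1) (prec i) -!mul_polyC.
ring.
Qed.
End Structure.

(** * The compatibility conditions for the sieved coefficients *)

Arguments sinU : simpl never.

Lemma block_divn k n j : (j < k)%N -> ((n * k + j) %/ k = n)%N.
Proof. by move=> jk; rewrite divnMDl; [rewrite divn_small ?addn0|lia]. Qed.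

Lemma block_modn k n j : (j < k)%N -> ((n * k + j) %% k = j)%N.
Proof. by move=> jk; rewrite modnMDl modn_small. Qed.

Section Sieved.
Variables (F : numFieldType) (k : nat) (lam : F).

(** [sieved_A] and [sieved_B] are the limits as s -> 1 of
    2 (1 - b q^m) / (1 - b^2 q^m) and (1 - q^m) / (1 - b^2 q^m), where
    b = s^(lam k) and q = s omega_k. *)
Definition sieved_A (m : nat) : F :=
  if (k %| m)%N then 2 * ((m %/ k)%:R + lam) / ((m %/ k)%:R + 2 * lam) else 2.

Definition sieved_B (m : nat) : F :=
  if (k %| m)%N then (m %/ k)%:R / ((m %/ k)%:R + 2 * lam) else 1.

Fixpoint sieved_rec n : {poly F} :=
  if n is m.+1 then
    if m is l.+1 then
      sieved_A m *: 'X * sieved_rec m - sieved_B m *: sieved_rec l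
    else 'X
  else 1.

Lemma sieved_recSS n : sieved_rec n.+2 =
  sieved_A n.+1 *: 'X * sieved_rec n.+1 - sieved_B n.+1 *: sieved_rec n.
Proof. by []. Qed.

(** Coefficient of the monic recurrence: [sieved_A] m is the ratio of the
    normalizing constants at m - 1 and m, so passing to monic polynomials
    divides [sieved_B] m by two consecutive values of [sieved_A].  For m = 1 the
    constant function 1 is already monic, hence a single division by 2. *)
Definition gamma (m : nat) : F :=
  if m == 1%N then 1 / 2 else sieved_B m / (sieved_A m * sieved_A m.-1).

Hypothesis k3 : (3 <= k)%N.
Hypothesis hlam2 : forall n : nat, (0 < n)%N -> n%:R + 2 * lam != 0.

Lemma natD_lam_neq0 n : (0 < n)%N -> n%:R + lam != 0.
Proof.
move=> n0; have := hlam2 n.*2; rewrite double_gt0 => /(_ n0).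
by rewrite -muln2 natrM mulrC -mulrDr mulf_eq0 negb_or => /andP[].
Qed.

Lemma ndvd_block n j : (0 < j < k)%N -> (k %| n * k + j)%N = false.
Proof.
by move=> /andP[j0 jk]; rewrite dvdn_addr ?dvdn_mull// gtnNdvd.
Qed.

Lemma gamma_block n j : (2 <= j < k)%N -> gamma (n * k + j)%N = 1 / 4.
Proof.
move=> jk; rewrite /gamma /sieved_A /sieved_B ifN; last by lia.
have -> : (n * k + j).-1 = (n * k + j.-1)%N by lia.
by rewrite !ndvd_block; [field|lia..].
Qed.

Lemma gamma_mulk n : (0 < n)%N -> gamma (n * k)%N = n%:R / (4 * (n%:R + lam)).
Proof.
move=> n0; rewrite /gamma /sieved_A /sieved_B ifN; last by nia.
have -> : (n * k).-1 = (n.-1 * k + k.-1)%N by case: n n0 => // n _; lia.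
rewrite ndvd_block; last by lia.
rewrite dvdn_mull// mulnK; last by lia.
by field; rewrite hlam2// natD_lam_neq0.
Qed.

Lemma gamma_mulk1 n : (0 < n)%N ->
  gamma (n * k + 1)%N = (n%:R + 2 * lam) / (4 * (n%:R + lam)).
Proof.
move=> n0; rewrite /gamma /sieved_A /sieved_B ifN; last by nia.
rewrite ndvd_block; last by lia.
rewrite addn1 /= dvdn_mull// mulnK; last by lia.
by field; rewrite hlam2// natD_lam_neq0.
Qed.

Local Notation S m := (sinU F m).

(** The regular expression for M_n at residue j modulo k, up to the factor
    2^(1-k).  It also makes sense at j = k. *)
Definition sineM (n j : nat) : {poly F} :=
  - (2 * (n%:R + lam * k%:R))%:P * S k - (2 * lam * k%:R)%:P * S (k%:Z - j%:Z - j%:Z).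

(** M and N are multiplied by 2^(k-1) here and in the next definition. *)
Definition scaledM (n j : nat) : {poly F} :=
  if j == 0%N then - (2 * ((n * k)%:R + lam * k%:R))%:P * S k else sineM (n * k + j)%N j.

Definition scaledN (n j : nat) : {poly F} :=
  ((n * k + j)%:R + 2 * lam * k%:R)%:P * 'X * S k - (lam * k%:R)%:P * S (k%:Z - 1)
  + (lam * k%:R)%:P * S (k%:Z - 1 - j%:Z - j%:Z).

Definition M_at i := scaledM (i %/ k) (i %% k).
Definition N_at i := scaledN (i %/ k) (i %% k).

(** At j = 0 the factor (n + 2 lam) of gamma_{nk+1} restores the term missing
    from M_{nk}: (n + 2 lam) k = (nk + lam k) + lam k.  For n = 0 this is the
    value gamma_1 = 1/2. *)
Lemma gamma_succ_scaledM n j : (j.+1 < k)%N ->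
  gamma (n * k + j.+1)%N *: scaledM n j = (1 / 4) *: sineM (n * k + j)%N j.
Proof.
case: j => [|j] jk; last by rewrite gamma_block.
rewrite /scaledM /sineM eqxx addn0 !subr0 -!mul_polyC.
have gE : gamma (n * k + 1)%N * (2 * ((n * k)%:R + lam * k%:R)) =
  1 / 4 * (2 * ((n * k)%:R + lam * k%:R) + 2 * lam * k%:R).
  have [->|n0] := posnP n.
    by rewrite mul0n add0n /gamma eqxx; field.
  by rewrite gamma_mulk1// natrM; field; rewrite natD_lam_neq0.
rewrite mulNr mulrN mulrA -polyCM gE.
ring.
Qed.

(** The case j = k is the other neighbour of a multiple of k: the factor n of
    gamma_{nk} gives nk = (nk + lam k) - lam k, the regular expression with
    S_{k-2k} = - S_k. *)
Lemma gamma_scaledM n j : (2 <= j <= k)%N ->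
  gamma (n * k + j)%N *: M_at (n * k + j)%N = (1 / 4) *: sineM (n * k + j)%N j.
Proof.
case: (ltngtP j k) => [jk|//|->]; rewrite ?andbF// andbT => j2.
  rewrite gamma_block ?j2// /M_at block_divn// block_modn//.
  by rewrite /scaledM ifN//; lia.
have -> : (n * k + k = n.+1 * k)%N by lia.
rewrite gamma_mulk// /M_at mulnK; last by lia.
rewrite modnMl /scaledM eqxx /sineM.
have -> : k%:Z - k%:Z - k%:Z = - k%:Z by lia.
have gE : n.+1%:R / (4 * (n.+1%:R + lam)) * (2 * ((n.+1 * k)%:R + lam * k%:R)) =
  1 / 4 * (2 * (n.+1 * k)%:R).
  by have := natD_lam_neq0 _ (ltn0Sn n); rewrite natrM; move: n.+1%:R => c c0; field.
rewrite sinUN -!mul_polyC mulNr mulrN mulrA -polyCM gE.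
ring.
Qed.

(** The indices i, i + 1, i + 2 either lie in one block of length k or cross its
    end after i + 1 or after i. *)
Variant block_position (i : nat) : Type :=
  | Inside n j of (j.+2 < k)%N & i = (n * k + j)%N
  | Penultimate n of i = (n * k + k.-2)%N
  | Last n of i = (n * k + k.-1)%N.

Lemma block_positionP i : block_position i.
Proof.
have ltk : (i %% k < k)%N by rewrite ltn_pmod; lia.
have iE := divn_eq i k.
have [jk|] := ltnP (i %% k).+2 k; first exact: Inside jk iE.
case: (ltngtP (i %% k).+1 k) => [lt|gt|e] h; [|lia|].
  by apply: (@Penultimate _ (i %/ k)%N); lia.
by apply: (@Last _ (i %/ k)%N); lia.
Qed.

(** Away from the block ends the S_k terms agree because both N and M are affine
    in the index, and the rest is S_{a+1} + S_{a-1} = 2 x S_a at a = k - 2j and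
    a = k - 2j - 2, where j is the residue of i + 1. *)
Lemma compat_next i : 'X * M_at i.+1 + N_at i = 'X * M_at i.+2 + N_at i.+2.
Proof.
case: (block_positionP i) => [n j jk|n|n] ->; rewrite /M_at /N_at.
- have -> : (n * k + j).+1 = (n * k + j.+1)%N by lia.
  have -> : (n * k + j.+1).+1 = (n * k + j.+2)%N by lia.
  rewrite !block_divn ?block_modn; try lia.
  rewrite /scaledM /scaledN /= /sineM.
  have -> : k%:Z - 1 - j%:Z - j%:Z = k%:Z - j.+1%:Z - j.+1%:Z + 1 by lia.
  have -> : k%:Z - 1 - j.+2%:Z - j.+2%:Z = k%:Z - j.+2%:Z - j.+2%:Z - 1 by lia.
  have aE : k%:Z - j.+1%:Z - j.+1%:Z - 1 = k%:Z - j.+2%:Z - j.+2%:Z + 1 by lia.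
  rewrite sinU_succ aE sinU_succ; ring.
- have -> : (n * k + k.-2).+1 = (n * k + k.-1)%N by lia.
  have -> : (n * k + k.-1).+1 = (n.+1 * k + 0)%N by lia.
  rewrite !block_divn ?block_modn; try lia.
  rewrite /scaledM /scaledN /= /sineM ifN; last by lia.
  have -> : k%:Z - 1 - k.-2%:Z - k.-2%:Z = - (k%:Z - 2 - 1) by lia.
  have -> : k%:Z - k.-1%:Z - k.-1%:Z = - (k%:Z - 2) by lia.
  have aE : k%:Z - 1 = k%:Z - 2 + 1 by lia.
  rewrite addn0; have -> : (n.+1 * k = n * k + k.-2 + 2)%N by lia.
  have -> : (n * k + k.-1 = n * k + k.-2 + 1)%N by lia.
  rewrite !subr0 aE !sinUN sinU_succ; ring.
have -> : (n * k + k.-1).+1 = (n.+1 * k + 0)%N by lia.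
have -> : (n.+1 * k + 0).+1 = (n.+1 * k + 1)%N by lia.
rewrite !block_divn ?block_modn; try lia.
rewrite /scaledM /scaledN /= /sineM.
have -> : k%:Z - 1 - k.-1%:Z - k.-1%:Z = - (k%:Z - 2 + 1) by lia.
have -> : k%:Z - 1 - 1%:Z - 1%:Z = k%:Z - 2 - 1 by lia.
have -> : k%:Z - 1%:Z - 1%:Z = k%:Z - 2 by lia.
have aE : k%:Z - 1 = k%:Z - 2 + 1 by lia.
have -> : (n.+1 * k = n * k + k.-1 + 1)%N by lia.
rewrite aE !sinUN sinU_succ; ring.
Qed.

Definition scaledPhi : {poly F} := (1 - 'X^2) * S k.

(** Regular products reduce this to S_{a+2} - S_{a-2} = 2 x (S_{a+1} - S_{a-1}).
    The case left is i + 1 = nk, where gamma_{nk} multiplies M_{nk-1} and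
    gamma_{nk+1} multiplies M_{nk+1}; only their sum 1/2 and the combination
    2 (gamma_{nk+1} - gamma_{nk}) (n + lam) = lam matter. *)
Lemma compat_same i : scaledPhi + 'X * (N_at i.+1 - N_at i) =
  gamma i.+1 *: M_at i - gamma i.+2 *: M_at i.+2.
Proof.
have generic n j : (j.+1 < k)%N -> i = (n * k + j)%N ->
    scaledPhi + 'X * (N_at i.+1 - N_at i) = gamma i.+1 *: M_at i - gamma i.+2 *: M_at i.+2.
  move=> jk ->.
  have -> : (n * k + j).+1 = (n * k + j.+1)%N by lia.
  have -> : (n * k + j.+1).+1 = (n * k + j.+2)%N by lia.
  rewrite gamma_scaledM; last by lia.
  rewrite /M_at /N_at !block_divn ?block_modn; try lia.
  rewrite gamma_succ_scaledM// /scaledPhi /scaledN /sineM -!mul_polyC.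
  have -> : k%:Z - j%:Z - j%:Z = k%:Z - j.+1%:Z - j.+1%:Z + 1 + 1 by lia.
  have -> : k%:Z - j.+2%:Z - j.+2%:Z = k%:Z - j.+1%:Z - j.+1%:Z - 1 - 1 by lia.
  have -> : k%:Z - 1 - j%:Z - j%:Z = k%:Z - j.+1%:Z - j.+1%:Z + 1 by lia.
  have -> : k%:Z - 1 - j.+1%:Z - j.+1%:Z = k%:Z - j.+1%:Z - j.+1%:Z - 1 by lia.
  move: (k%:Z - j.+1%:Z - j.+1%:Z) => a.
  have sE : 2 * 'X * S (a - 1) = S a + S (a - 1 - 1).
    by have := sinU_succ F (a - 1); rewrite subrK => ->; ring.
  have -> : S (a - 1 - 1) = 2 * 'X * S (a - 1) - S a by rewrite sE; ring.
  rewrite (sinU_succ F (a + 1)) addrK sinU_succ.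
  (* Clearing the denominator 4, as {poly F} is only a ring. *)
  have c4 : 4 * (1 / 4)%:P = 1 :> {poly F}.
    by rewrite -[4]/(4%:R) -polyC_natr -polyCM mulrA mulr1 divff ?pnatr_eq0.
  rewrite -[LHS]mul1r -[X in X * _ = _]c4; ring.
case: (block_positionP i) => [n j jk|n|n] iE; [apply: generic iE; lia..|].
rewrite iE.
have -> : (n * k + k.-1).+1 = (n.+1 * k)%N by lia.
have -> : (n.+1 * k).+1 = (n.+1 * k + 1)%N by lia.
rewrite gamma_mulk// gamma_mulk1//.
rewrite -{1}[(n.+1 * k)%N]addn0 /M_at /N_at !block_divn ?block_modn; try lia.
rewrite /scaledPhi /scaledN /scaledM ifN /=; last by lia.
rewrite /sineM -!mul_polyC.
have -> : k%:Z - 1 - k.-1%:Z - k.-1%:Z = - (k%:Z - 1) by lia.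
have -> : k%:Z - k.-1%:Z - k.-1%:Z = - (k%:Z - 1 - 1) by lia.
have -> : k%:Z - 1%:Z - 1%:Z = k%:Z - 1 - 1 by lia.
have kE : S k = 2 * 'X * S (k%:Z - 1) - S (k%:Z - 1 - 1).
  by rewrite -sinU_succ subrK.
rewrite !sinUN.
have -> : S (k%:Z - 1 - 1) = 2 * 'X * S (k%:Z - 1) - S k by rewrite kE; ring.
have -> : (n * k + k.-1)%:R = n.+1%:R * k%:R - 1 :> F.
  by rewrite -natrM -[X in _ - X]/(1%:R) -natrB; [congr (_%:R); lia|lia].
rewrite !subr0 addn0 natrD natrM.
have c0 := natD_lam_neq0 _ (ltn0Sn n); move: n.+1%:R c0 => c c0.
set u := c / _; set v := (c + _) / _.
have uDv : 2 * u + 2 * v = 1 by rewrite /u /v; field.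
have uBv : - (2 * (u - v) * (c + lam)) = lam by rewrite /u /v; field.
move: (S (k%:Z - 1)) => S1.
transitivity ((2 * u + 2 * v + k%:R * - (2 * (u - v) * (c + lam)))%:P * S k
  + (lam * k%:R * (2 * u + 2 * v))%:P * (2 * 'X * S1 - S k)).
  rewrite uDv uBv; ring.
ring.
Qed.

End Sieved.
Arguments sieved_A {F} k lam m.
Arguments sieved_B {F} k lam m.
Arguments sieved_rec {F} k lam n.
Arguments gamma {F} k lam m.

(** * Powers of s near s = 1 *)

Section Lim.
Variable R : realType.
Local Notation C := R[i].

(** The mode of convergence that defines [sieved]. *)
Definition tends (f : R -> C) (l : C) :=
  (f s : C^o) @[s --> (1 : R)^'-] --> (l : C^o).

Lemma tends_cst (c : C) : tends (fun=> c) c.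
Proof. exact: cvg_cst. Qed.

Lemma tendsB {f g a b} : tends f a -> tends g b -> tends (fun s => f s - g s) (a - b).
Proof. exact: cvgB. Qed.

Lemma tendsD {f g a b} : tends f a -> tends g b -> tends (fun s => f s + g s) (a + b).
Proof. exact: cvgD. Qed.

Lemma tendsM {f g a b} : tends f a -> tends g b -> tends (fun s => f s * g s) (a * b).
Proof. exact: (@cvgM (C : numFieldType)). Qed.

Lemma tendsV {f a} : a != 0 -> tends f a -> tends (fun s => (f s)^-1) a^-1.
Proof. exact: (@cvgV (C : numFieldType)). Qed.

Lemma tends_unique {f a b} : tends f a -> tends f b -> a = b.
Proof. exact: (cvg_unique (@norm_hausdorff _ C^o)). Qed.

Lemma tends_near {f g a} : (\forall s \near (1 : R)^'-, f s = g s) ->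
  tends f a -> tends g a.
Proof.
by move=> fg fa; apply: cvg_trans fa; exact: near_eq_cvg.
Qed.

Lemma tends_real {f : R -> R} {a : R} :
  f s @[s --> 1^'-] --> a -> tends (fun s => (f s)%:C) a%:C.
Proof.
move=> fa; apply/cvgrPdist_lt => -[e e'] /[1!ltcE] /= /andP[/eqP -> e0].
near=> s.
rewrite -rmorphB normc_def /= expr0n addr0 sqrtr_sqr ltcR.
by near: s; move/cvgrPdist_lt: fa; apply.
Unshelve. all: by end_near. Qed.

Lemma cvg_slope {f : R -> R} {a d : R} : is_derive a (1 : R) f d ->
  (f s - f a) / (s - a) @[s --> a^'-] --> d.
Proof.
move=> [df <-]; move/cvg_ex: (df) => [l dfl].
rewrite /derive (cvg_lim _ dfl)//.
move/cvg_dnbhs_at_left/cvgrPdist_lt: dfl => dfl.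
apply/cvgrPdist_lt => e /dfl /nbhs_left0P near0; apply/nbhs_left0P.
apply: filterS near0 => h.
rewrite /= sub0r scaler1 /shift /=.
by rewrite [a - h]addrC addrK mulrC.
Qed.

(** For z = a + ib, s^z = e^(a ln s) (cos (b ln s) + i sin (b ln s)); to first
    order at s = 1 only a ln s contributes to the real part and b ln s to the
    imaginary part. *)
Lemma is_derive_cpow_Re (z : C) :
  is_derive (1 : R) (1 : R) (fun s => complex.Re (cpow s z)) (complex.Re z).
Proof.
case: z => a b /=.
have dln : is_derive (1 : R) (1 : R) (@ln R) 1.
  by rewrite -[X in is_derive _ _ _ X]invr1; exact: is_derive1_ln.
have E: (fun s : R => complex.Re (cpow s (a +i* b))) = (fun s => expR (ln s * a) * cos (ln s * b)).
  by apply/funext => s; rewrite /cpow /cexp /=; simpc => /=.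
rewrite E; apply: is_derive_eq.
rewrite /GRing.scale /= ln1 !mul0r expR0 cos0 sin0.
ring.
Qed.

Lemma is_derive_cpow_Im (z : C) :
  is_derive (1 : R) (1 : R) (fun s => complex.Im (cpow s z)) (complex.Im z).
Proof.
case: z => a b /=.
have dln : is_derive (1 : R) (1 : R) (@ln R) 1.
  by rewrite -[X in is_derive _ _ _ X]invr1; exact: is_derive1_ln.
have E: (fun s : R => complex.Im (cpow s (a +i* b))) = (fun s => expR (ln s * a) * sin (ln s * b)).
  by apply/funext => s; rewrite /cpow /cexp /=; simpc => /=.
rewrite E; apply: is_derive_eq.
rewrite /GRing.scale /= ln1 !mul0r expR0 cos0 sin0.
ring.
Qed.

Lemma cpow1 (z : C) : cpow 1 z = 1.
Proof.
by rewrite /cpow ln1 mul0r /cexp /= expR0 cos0 sin0 mul1r.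
Qed.

(** The derivative of s^z at s = 1 is z, approached from the left. *)
Lemma tends_cpow_slope (z : C) :
  tends (fun s => (1 - cpow s z) / (1 - s%:C)) z.
Proof.
have dRe := cvg_slope (is_derive_cpow_Re z).
have dIm := cvg_slope (is_derive_cpow_Im z).
rewrite cpow1 in dRe dIm.
rewrite [X in tends _ X]complexE.
apply: tends_near; last first.
  apply: tendsD (tends_real dRe) _.
  exact: tendsM (tends_cst 'i%C) (tends_real dIm).
apply: nearW => s.
rewrite [X in _ = (_ - X) / _]complexE.
move: (complex.Re _) (complex.Im (cpow s z)) => a b.
rewrite !rmorphM !fmorphV !rmorphB /= mulrA -mulrDl subr0.
rewrite -[X in _ = X / _]opprB -[1 - s%:C]opprB invrN mulrNN.
by congr (_ / _); rewrite addrAC.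
Qed.

Lemma tends_id : tends (fun s => s%:C) 1.
Proof. by apply: tends_real; exact: cvg_at_left_filter. Qed.

Lemma tends_cpow (z : C) : tends (fun s => cpow s z) 1.
Proof.
have -> : (1 : C) = 1 - z * (1 - 1) by rewrite subrr mulr0 subr0.
apply: tends_near; last first.
  apply: tendsB (tends_cst 1) _.
  exact: tendsM (tends_cpow_slope z) (tendsB (tends_cst 1) tends_id).
near=> s.
rewrite divfK ?subKr// subr_eq0 -(rmorph1 (real_complex R)).
by apply/eqP => /complexI s1; have : s < 1; [near: s; exact: nbhs_left_lt | rewrite -s1 ltxx].
Unshelve. all: by end_near. Qed.

Lemma tends_cpow_ratio (w z : C) : z != 0 ->
  tends (fun s => (1 - cpow s w) / (1 - cpow s z)) (w / z).
Proof.
move=> z0; apply: tends_near; last first.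
  exact: tendsM (tends_cpow_slope w) (tendsV z0 (tends_cpow_slope z)).
near=> s.
rewrite invf_div mulrA divfK// subr_eq0 -(rmorph1 (real_complex R)).
by apply/eqP => /complexI s1; have : s < 1; [near: s; exact: nbhs_left_lt | rewrite -s1 ltxx].
Unshelve. all: by end_near. Qed.

Lemma cexpD (z w : C) : cexp (z + w) = cexp z * cexp w.
Proof.
case: z w => [a b] [c d]; rewrite /cexp /=; simpc => /=.
by rewrite expRD cosD sinD; congr (_ +i* _); ring.
Qed.

Lemma cpowD (s : R) (z w : C) : cpow s (z + w) = cpow s z * cpow s w.
Proof. by rewrite /cpow mulrDr cexpD. Qed.

Lemma cexp0 : cexp (0 : C) = 1.
Proof. by rewrite /cexp /= expR0 cos0 sin0 mul1r. Qed.

Lemma cexpMn (z : C) n : cexp (z * n%:R) = cexp z ^+ n.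
Proof.
elim: n => [|n IH]; first by rewrite mulr0 cexp0.
by rewrite -natr1 mulrDr mulr1 cexpD IH exprSr.
Qed.

Lemma cpow_nat (s : R) n : 0 < s -> cpow s n%:R = s%:C ^+ n.
Proof.
move=> s0; rewrite /cpow cexpMn; congr (_ ^+ _).
by rewrite /cexp /= lnK ?posrE// cos0 sin0 mulr1.
Qed.

(** By cos (2 u) = 2 cos^2 u - 1, the value 1 forces sin u = 0 at
    u = pi r / k, which is impossible for 0 < r < k. *)
Lemma omega_expn_eq1 k m : (0 < k)%N -> (omega R k ^+ m == 1) = (k %| m)%N.
Proof.
move=> k0; have kR : k%:R != 0 :> R by rewrite pnatr_eq0 -lt0n.
have omegaE r : omega R k ^+ r =
    cos (2 * (pi * r%:R / k%:R)) +i* sin (2 * (pi * r%:R / k%:R)).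
  rewrite -cexpMn /cexp -(rmorph_nat (real_complex R)) /=.
  rewrite !(mul0r, mulr0, add0r, oppr0) expR0 mul1r.
  by congr (cos _ +i* sin _); field.
have omegak : omega R k ^+ k = 1.
  by rewrite omegaE mulfK// -[2 * _]mulrC mulr_natr cos2pi sin2pi.
rewrite {1}(divn_eq m k) exprD mulnC exprM omegak expr1n mul1r.
rewrite /dvdn; have := ltn_pmod m k0; set r := (m %% k)%N => rk.
have [->|r0] := eqVneq r 0%N; first by rewrite expr0 eqxx.
apply/eqP; rewrite omegaE => -[c1 _].
have : 0 < sin (pi * r%:R / k%:R : R).
  apply: sin_gt0_pi; rewrite divr_gt0 ?mulr_gt0 ?pi_gt0 ?ltr0n// ?lt0n//=.
  by rewrite ltr_pdivrMr ?ltr0n// ltr_pM2l ?pi_gt0// ltr_nat.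
move: c1; rewrite mulr_natl cos_mulr2n => c1.
have := cos2Dsin2 (pi * r%:R / k%:R : R) => cs s0.
have : 0 < sin (pi * r%:R / k%:R : R) ^+ 2 by rewrite exprn_gt0.
by rewrite mulr2n in c1; lra.
Qed.

(** * The sieved polynomials as limits *)

Lemma qultraSS (b q : C) n : qultra b q n.+2 =
  (1 - b ^+ 2 * q ^+ n.+1)^-1 *:
    ((2 * (1 - b * q ^+ n.+1)) *: 'X * qultra b q n.+1 -
     (1 - q ^+ n.+1) *: qultra b q n).
Proof. by []. Qed.

Variables (k : nat) (lam : C).
Hypothesis k0 : (0 < k)%N.
Hypothesis hlam2 : forall n : nat, (0 < n)%N -> n%:R + 2 * lam != 0.

Let b s := cpow s (lam * k%:R).
Let q s := s%:C * omega R k.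

Lemma tends_b : tends b 1. Proof. exact: tends_cpow. Qed.

Lemma tends_qX m : tends (fun s => q s ^+ m) (omega R k ^+ m).
Proof.
elim: m => [|m IH]; first exact: tends_cst.
have -> : (fun s => q s ^+ m.+1) = (fun s => (s%:C * omega R k) * q s ^+ m).
  by apply/funext => s; rewrite exprS.
rewrite exprS; apply: tendsM IH.
by rewrite -[X in tends _ X]mul1r; exact: tendsM tends_id (tends_cst _).
Qed.

(** The root of unity disappears at multiples of k, so that b q^m and b^2 q^m
    become powers of s alone. *)
Lemma q_mulk n s : 0 < s -> q s ^+ (n * k) = cpow s (n * k)%:R.
Proof.
move=> s0; rewrite exprMn cpow_nat// [X in _ * X](_ : _ = 1) ?mulr1//.
by apply/eqP; rewrite omega_expn_eq1// dvdn_mull.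
Qed.

(** For m = nk both quotients are of the form 0/0 and the exponents
    lam k + nk, nk and 2 lam k + nk decide; otherwise the denominator tends to
    1 - omega_k^m, which is nonzero. *)
Lemma tends_coef m : (0 < m)%N ->
  tends (fun s => (1 - b s * q s ^+ m) / (1 - b s ^+ 2 * q s ^+ m))
        (sieved_A k lam m / 2) /\
  tends (fun s => (1 - q s ^+ m) / (1 - b s ^+ 2 * q s ^+ m)) (sieved_B k lam m).
Proof.
rewrite /sieved_A /sieved_B => m0; case: ifPn => [/dvdnP[n mE]|km].
  have n0 : (0 < n)%N by move: m0; rewrite mE muln_gt0 => /andP[].
  rewrite mE mulnK//.
  have kC : k%:R != 0 :> C by rewrite pnatr_eq0 -lt0n.
  have dC := hlam2 n n0.
  have zE : (lam * k%:R) *+ 2 + (n * k)%:R = (n%:R + 2 * lam) * k%:R.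
    by rewrite natrM -mulr_natl; ring.
  have zC : (lam * k%:R) *+ 2 + (n * k)%:R != 0 by rewrite zE mulf_neq0.
  have bq s : 0 < s -> b s * q s ^+ (n * k) = cpow s (lam * k%:R + (n * k)%:R).
    by move=> s0; rewrite q_mulk// cpowD.
  have bbq s : 0 < s ->
      b s ^+ 2 * q s ^+ (n * k) = cpow s ((lam * k%:R) *+ 2 + (n * k)%:R).
    by move=> s0; rewrite q_mulk// !cpowD expr2.
  split.
    have -> : 2 * (n%:R + lam) / (n%:R + 2 * lam) / 2
           = (lam * k%:R + (n * k)%:R) / ((lam * k%:R) *+ 2 + (n * k)%:R).
      by rewrite zE natrM; field; rewrite kC dC.
    apply: tends_near _ (tends_cpow_ratio _ _ zC); near=> s.
    have s0 : 0 < s by near: s; exact: nbhs_left_gt.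
    by rewrite bbq ?bq.
  have -> : n%:R / (n%:R + 2 * lam)
         = (n * k)%:R / ((lam * k%:R) *+ 2 + (n * k)%:R).
    by rewrite zE natrM; field; rewrite kC dC.
  apply: tends_near _ (tends_cpow_ratio _ _ zC); near=> s.
  have s0 : 0 < s by near: s; exact: nbhs_left_gt.
  by rewrite bbq ?q_mulk.
have wC : 1 - 1 ^+ 2 * omega R k ^+ m != 0.
  by rewrite expr1n mul1r subr_eq0 eq_sym omega_expn_eq1.
have tden : tends (fun s => (1 - b s ^+ 2 * q s ^+ m)^-1)
                  (1 - 1 ^+ 2 * omega R k ^+ m)^-1.
  apply: tendsV wC _; apply: tendsB (tends_cst 1) _.
  apply: tendsM (tends_qX m).
  exact: tendsM tends_b tends_b.
split.
  have -> : 2 / 2 = (1 - 1 * omega R k ^+ m) / (1 - 1 ^+ 2 * omega R k ^+ m).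
    rewrite expr1n mul1r divff// divff//.
    by move: wC; rewrite expr1n mul1r.
  apply: tendsM _ tden; apply: tendsB (tends_cst 1) _.
  exact: tendsM tends_b (tends_qX m).
have oneE : 1 = (1 - omega R k ^+ m) / (1 - 1 ^+ 2 * omega R k ^+ m).
  rewrite expr1n mul1r divff//.
  by move: wC; rewrite expr1n mul1r.
rewrite [X in tends _ X]oneE; apply: tendsM _ tden.
exact: tendsB (tends_cst 1) (tends_qX m).
Unshelve. all: by end_near. Qed.

Lemma tends_qsieved n x :
  tends (fun s => (qsieved k lam n s).[x]) (sieved_rec k lam n).[x].
Proof.
suff: tends (fun s => (qsieved k lam n s).[x]) (sieved_rec k lam n).[x] /\
  tends (fun s => (qsieved k lam n.+1 s).[x]) (sieved_rec k lam n.+1).[x] by case.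
elim: n => [|n [IH0 IH1]].
  split; first exact: tends_cst.
  have -> : (sieved_rec k lam 1).[x] = 2 / (1 + 1) * x by rewrite /= hornerX divff ?mul1r.
  have -> : (fun s => (qsieved k lam 1 s).[x]) = (fun s => 2 * (1 + b s)^-1 * x).
    by apply/funext => s; rewrite /qsieved /= !hornerE.
  apply: tendsM (tends_cst x); apply: tendsM (tends_cst 2) _.
  by apply: tendsV; [|exact: tendsD (tends_cst 1) tends_b].
split=> //.
have [tA tB] := tends_coef n.+1 isT.
have -> : (sieved_rec k lam n.+2).[x] =
   (2 * (sieved_A k lam n.+1 / 2)) * x * (sieved_rec k lam n.+1).[x] - sieved_B k lam n.+1 * (sieved_rec k lam n).[x].
  rewrite sieved_recSS [2 * (_ / 2)]mulrC divfK //.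
  by move: (sieved_rec k lam n.+1) (sieved_rec k lam n) => p1 p0; rewrite !hornerE.
apply: tends_near; last first.
  apply: tendsB (tendsM tB IH0).
  apply: tendsM IH1; apply: tendsM (tends_cst x); exact: tendsM (tends_cst 2) tA.
apply: nearW => s; rewrite /qsieved qultraSS.
move: (qultra _ _ n.+1) => p1; rewrite !(hornerZ, hornerD, hornerN, hornerM, hornerX).
by rewrite -/(b s) -/(q s); ring.
Qed.

(** The difference vanishes at all natural numbers, too many roots for a nonzero
    polynomial in characteristic zero. *)
Lemma poly_ext (p r : {poly C}) : (forall x, p.[x] = r.[x]) -> p = r.
Proof.
move=> pr; apply/eqP; rewrite -subr_eq0; apply/eqP.
apply: (@roots_geq_poly_eq0 _ _ [seq i%:R | i <- iota 0 (size (p - r))]).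
- by apply/allP => x _; rewrite rootE !hornerE pr subrr.
- rewrite map_inj_uniq ?iota_uniq//.
  by move=> i j /eqP; rewrite eqr_nat => /eqP.
- by rewrite size_map size_iota.
Qed.

Lemma sievedE n : sieved k lam n = sieved_rec k lam n.
Proof.
apply: xget_unique => [x|p hp]; first exact: tends_qsieved.
by apply: poly_ext => x; apply: tends_unique (hp x) (tends_qsieved n x).
Qed.

End Lim.

(** * The structure relation *)

Section Final.
Variables (R : realType) (k : nat) (lam : R[i]).
Local Notation C := R[i].
Hypothesis k3 : (3 <= k)%N.
Hypothesis hlam2 : forall n : nat, (0 < n)%N -> n%:R + 2 * lam != 0.

Let two_neq0 : 2 != 0 :> C. Proof. by rewrite pnatr_eq0. Qed.
Let pow2_neq0 n : 2 ^+ n != 0 :> C. Proof. exact: expf_neq0. Qed.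

Lemma sieved_PhiE : sieved_Phi R k = (2 / 2 ^+ k) *: scaledPhi C k.
Proof. by rewrite /sieved_Phi monicU_sinU -scalerAr. Qed.

(** At j = 0 both products contain a Chebyshev polynomial of negative index; this
    is where the term in S_{k-2j} disappears. *)
Lemma sieved_ME n j : (j < k)%N ->
  sieved_M k lam n j = (2 / 2 ^+ k) *: scaledM C k lam n j.
Proof.
rewrite /sieved_M /scaledM monicU_sinU; case: j => [|j] jk.
  by rewrite !mul0r subrr scaler0 subr0 addn0 -!mul_polyC; ring.
have [l kE] : exists l, k = (j + l + 2)%N by exists (k - j - 2)%N; lia.
have -> : k%:Z - j.+1%:Z - 2 = l%:Z - 1 by lia.
have -> : j.+1%:Z - 2 = j%:Z - 1 by lia.
have -> : k%:Z - j.+1%:Z - 1 = l.+1%:Z - 1 by lia.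
rewrite monicU_cross /= /sineM.
have -> : k%:Z - j.+1%:Z - j.+1%:Z = l%:Z - j%:Z by lia.
have -> : 2 / 2 ^+ (j + l) = 4 * (2 / 2 ^+ k) :> C.
  by rewrite kE !exprD; field; rewrite !pow2_neq0.
have -> : 2 * lam * k%:R = 4 * (lam * k%:R / 2) by field.
rewrite -!mul_polyC; move: (lam * k%:R / 2) => c; ring.
Qed.

(** At j = 0 and j = k - 1 the products vanish while the regular expression
    contains S_{k-1-2j} = S_{k-1}, respectively - S_{k-1}; the values 0 and 1 of
    eps, in place of 1/2, supply exactly that term. *)
Lemma sieved_NE n j : (j < k)%N ->
  sieved_N k lam n j = (2 / 2 ^+ k) *: scaledN C k lam n j.
Proof.
move=> jk; rewrite /sieved_N /scaledN monicU_sinU.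
have [l kE] : exists l, k = (l + 2)%N by exists (k - 2)%N; lia.
have -> : k%:Z - 2 = k.-1%:Z - 1 by lia.
have -> : k%:Z - 1 = k.-1%:Z by lia.
rewrite monicU_sinU.
have -> : 2 / 2 ^+ k.-1 = 2 * (2 / 2 ^+ k) :> C.
  have -> : k = k.-1.+1 by lia.
  by rewrite exprS /=; field; rewrite !pow2_neq0.
rewrite /sieved_eps.
have [->|j0] := eqVneq j 0%N.
  rewrite !mul0r subrr scaler0 !subr0 -!mul_polyC; ring.
have [->|jk1] := eqVneq j k.-1.
  have -> : k%:Z - k.-1%:Z - 3 = - 2 by lia.
  have -> : k%:Z - k.-1%:Z - 2 = - 1 by lia.
  have -> : k.-1%:Z - k.-1%:Z - k.-1%:Z = - k.-1%:Z by lia.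
  rewrite sinUN !mulr0 subrr scaler0 -!mul_polyC; ring.
case: j j0 jk jk1 => // j _ jk jk1.
have {l kE} [l kE] : exists l, k = (j + l + 3)%N by exists (k - j - 3)%N; lia.
have -> : k%:Z - j.+1%:Z - 3 = l%:Z - 1 by lia.
have -> : j.+1%:Z - 2 = j%:Z - 1 by lia.
have -> : k%:Z - j.+1%:Z - 2 = l.+1%:Z - 1 by lia.
rewrite monicU_cross /=.
have -> : k.-1%:Z - j.+1%:Z - j.+1%:Z = l%:Z - j%:Z by lia.
have -> : 2 / 2 ^+ (j + l) = 8 * (2 / 2 ^+ k) :> C.
  by rewrite kE !exprD; field; rewrite !pow2_neq0.
have -> : lam * k%:R * (1 / 2) = 4 * (lam * k%:R / 8) by field.
have -> : (lam * k%:R)%:P = (8 * (lam * k%:R / 8))%:P :> {poly C}.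
  by congr _%:P; field.
rewrite -!mul_polyC; move: (lam * k%:R / 8) => c; ring.
Qed.

Lemma pochhammerS (a : C) n : pochhammer a n.+1 = pochhammer a n * (a + n%:R).
Proof. by rewrite /pochhammer big_ord_recr. Qed.

Lemma pochhammer_neq0 n : pochhammer (lam + 1) n != 0.
Proof.
apply/prodf_neq0 => i _; rewrite -addrA nat1r addrC.
exact: (natD_lam_neq0 _ _ hlam2).
Qed.

Lemma vartheta_A m : vartheta k lam m.+1 * sieved_A k lam m.+1 = vartheta k lam m.
Proof.
rewrite /vartheta /sieved_A divnS; last by lia.
have pn := pochhammer_neq0 (m %/ k).
case: ifPn => km; last first.
  by rewrite add0n exprS; field; rewrite pn pow2_neq0.
rewrite km !add1n !pochhammerS exprS.
have c0 := hlam2 _ (ltn0Sn (m %/ k)); have c1 := natD_lam_neq0 _ _ hlam2 _ (ltn0Sn (m %/ k)).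
move: c0 c1; rewrite -[(m %/ k).+1%:R]natr1; move: (m %/ k)%:R => c c0 c1.
field; rewrite pn pow2_neq0.
by rewrite c0 -addrA addrC (addrC 1) c1.
Qed.

(** Two steps of [vartheta_A] turn the coefficient of the previous polynomial
    into gamma. *)
Lemma vartheta_B m : vartheta k lam m.+2 * sieved_B k lam m.+2 =
  gamma k lam m.+2 * vartheta k lam m.
Proof.
rewrite -(vartheta_A m) -(vartheta_A m.+1) /gamma /=.
have A0 i : sieved_A k lam i.+1 != 0.
  rewrite /sieved_A; case: ifPn => // /dvdnP[n iE].
  have n0 : (0 < n)%N by case: n iE.
  rewrite iE mulnK; last by lia.
  by rewrite mulf_neq0 ?mulf_neq0 ?invr_eq0 ?hlam2// (natD_lam_neq0 _ _ hlam2).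
by field; rewrite !A0.
Qed.

Local Notation p := (monic_sieved k lam).

Lemma monic_sieved_rec i : p i.+2 = 'X * p i.+1 - gamma k lam i.+1 *: p i.
Proof.
have k0 : (0 < k)%N by lia.
rewrite /monic_sieved !sievedE// sieved_recSS scalerBr scalerA.
rewrite -scalerAl scalerA vartheta_A -scalerAr; congr (_ - _).
case: i => [|i]; last by rewrite vartheta_B scalerA.
rewrite /sieved_B ifN; last by rewrite gtnNdvd//; lia.
congr (_ *: _).
by rewrite /vartheta /gamma /= divn_small ?/pochhammer ?big_ord0 ?mulr1 ?expr1//; lia.
Qed.

Lemma monic_sieved0 : p 0 = 1. Proof. by []. Qed.

Lemma monic_sieved1 : p 1 = 'X.
Proof.
rewrite /monic_sieved sievedE//; last by lia.
rewrite /vartheta div0n /pochhammer !big_ord0 expr0 mulr1 divr1.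
exact: scale1r.
Qed.

Lemma structure_relation i :
  scaledPhi C k * (p i)^`() = M_at C k lam i * p i.+1 + N_at C k lam i * p i.
Proof.
apply: (structure_relation_ind C p (M_at C k lam) (N_at C k lam) (gamma k lam)).
- exact: monic_sieved_rec.
- exact: compat_next.
- exact: compat_same.
- rewrite monic_sieved0 monic_sieved1 poly.derivE /M_at /N_at div0n mod0n /scaledM /scaledN /=.
  by rewrite mul0n !subr0; ring.
rewrite monic_sieved_rec monic_sieved0 monic_sieved1 poly.derivE -mul_polyC.
have -> : gamma k lam 1 = 1 / 2 by [].
rewrite /M_at /N_at divn_small ?modn_small; try lia.
rewrite /scaledPhi /scaledM /scaledN /sineM /=.
have -> : k%:Z - 1 - 1 - 1 = k%:Z - 2 - 1 by lia.
have -> : k%:Z - 1 - 1 = k%:Z - 2 by lia.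
have kE : sinU C k = 2 * 'X * sinU C (k%:Z - 1) - sinU C (k%:Z - 2).
  have -> : k%:Z - 2 = k%:Z - 1 - 1 by lia.
  by rewrite -sinU_succ subrK.
have k1E : sinU C (k%:Z - 1) = 2 * 'X * sinU C (k%:Z - 2) - sinU C (k%:Z - 2 - 1).
  rewrite -sinU_succ; congr sinU; lia.
(* With h = 1/2, the difference of the two sides is a multiple of 2 h - 1. *)
have half2 : 2 * (1 / 2)%:P - 1 = 0 :> {poly C}.
  by rewrite -[2]/(2%:R) -polyC_natr -polyCM mulrA mulr1 divff// subrr.
pose Y := (1 + lam * k%:R)%:P * sinU C k + (lam * k%:R)%:P * sinU C (k%:Z - 2).
rewrite -[LHS]addr0 -(mulr0 Y) -half2 /Y kE k1E; ring.
Qed.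
End Final.

Theorem theorem5p2 (R : realType) (k : nat) (lam : R[i])
    (hk : (3 <= k)%N)
    (hlam : forall m : nat, (1 <= m)%N -> lam <> - (m%:R / 2))
    (n j : nat) (hj : (j <= k - 1)%N) :
  sieved_Phi R k * (monic_sieved k lam (n * k + j))^`() =
    sieved_M k lam n j * monic_sieved k lam (n * k + j + 1)
    + sieved_N k lam n j * monic_sieved k lam (n * k + j).
Proof.
have jk : (j < k)%N by lia.
have hlam2 m : (0 < m)%N -> m%:R + 2 * lam != 0.
  move=> m0; apply/eqP => e; apply: (hlam m m0).
  have -> : m%:R = - (2 * lam) by apply/eqP; rewrite -addr_eq0 e.
  by field.
have := structure_relation R k lam hk hlam2 (n * k + j)%N.
rewrite /M_at /N_at block_divn// block_modn// addn1 => rel.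
by rewrite sieved_PhiE sieved_ME// sieved_NE// -!scalerAl rel scalerDr.
Qed.
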